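(* Let $\mathcal{X},\mathcal{Y}$ be sets, let $\mathcal{S}$ be a probability distribution on $\mathcal{X}\times\mathcal{Y}$, and let $\mathcal{P}$ be a family of functions $P:\mathcal{X}\to\mathcal{Y}$ and $\mathcal{D}$ a family of functions $D:\mathcal{Y}\to\mathcal{X}$. Let $\mathcal{H}_{dual}\subseteq\mathcal{P}\times\mathcal{D}$ be an infinite set of pairs $(P,D)$. Let $\ell_1:\mathcal{Y}\times\mathcal{Y}\to\mathbb{R}$ and $\ell_2:\mathcal{X}\times\mathcal{X}\to\mathbb{R}$ be loss functions and $M$ a real number such that, for every $(P,D)\in\mathcal{H}_{dual}$, the map $(x,y)\mapsto \ell_1(P(x),y)+\ell_2(D(P(x)),x)$ takes values in $[0,M]$ on $\mathcal{X}\times\mathcal{Y}$. Let $m\ge 1$ and let $\mathcal{Z}=\{z_1,\dots,z_m\}$, $z_i=(x_i,y_i)$, be a sample of $m$ points drawn independently from $\mathcal{S}$. Then for any $\delta>0$, each of the following two assertions holds with probability at least $1-\delta$ over the draw of $\mathcal{Z}$: (i) for all $(P,D)\in\mathcal{H}_{dual}$, $$E(P,D)\le \widehat{E}(P,D)+2R_m^{DL}(\mathcal{H}_{dual})+M\sqrt{\frac{1}{2m}\log\left(\frac{1}{\delta}\right)};$$ (ii) for all $(P,D)\in\mathcal{H}_{dual}$, $$E(P,D)\le \widehat{E}(P,D)+2\widehat{R}_{\mathcal{Z}}^{DL}(\mathcal{H}_{dual})+3M\sqrt{\frac{1}{2m}\log\left(\frac{1}{\delta}\right)}.$$ Here $E$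 is the expected loss, $\widehat{E}$ the empirical loss on $\mathcal{Z}$, and $R_m^{DL}$, $\widehat{R}_{\mathcal{Z}}^{DL}$ are the Rademacher complexity and the empirical Rademacher complexity of dual learning, respectively.
   Context: Definitions, for $(P,D)\in\mathcal{H}_{dual}$ and a sample $\mathcal{Z}=\{(x_1,y_1),\dots,(x_m,y_m)\}$: - Generalization error (expected loss): $E(P,D)=\mathbb{E}_{(x,y)\sim\mathcal{S}}\left[\ell_1(P(x),y)+\ell_2(D(P(x)),x)\right]$. - Empirical loss: $\widehat{E}(P,D)=\frac1m\sum_{i=1}^m\left(\ell_1(P(x_i),y_i)+\ell_2(D(P(x_i)),x_i)\right)$. - Empirical Rademacher complexity of dual learning: $$\widehat{R}_{\mathcal{Z}}^{DL}(\mathcal{H}_{dual})=\mathbb{E}_{\sigma}\left[\sup_{(P,D)\in\mathcal{H}_{dual}}\frac1m\sum_{i=1}^m\sigma_i\left(\ell_1(P(x_i),y_i)+\ell_2(D(P(x_i)),x_i)\right)\right],$$ where $\sigma=(\sigma_1,\dots,\sigma_m)$ are independent random variables, each uniform on $\{-1,+1\}$. - Rademacher complexity of dual learning: $R_m^{DL}(\mathcal{H}_{dual})=\mathbb{E}_{\mathcal{Z}}\left[\widehat{R}_{\mathcal{Z}}^{DL}(\mathcal{H}_{dual})\right]$, the expectation being over samples $\mathcal{Z}$ of $m$ independent points drawn from $\mathcal{S}$. Conventions: $\log$ is the natural logarithm. When $\delta\ge1$ the assertions are vacuous since $1-\delta\le 0$. All functions whose expectations or probabilities appear are implicitly assumed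 measurable. *)

(* Defs.v *)
From HB Require Import structures.
From mathcomp Require Import all_boot all_order all_algebra.
From mathcomp Require Import all_classical all_reals all_analysis.

Set Implicit Arguments.
Unset Strict Implicit.
Unset Printing Implicit Defensive.

Import Order.TTheory GRing.Theory Num.Theory.
Import numFieldNormedType.Exports.

Local Open Scope classical_set_scope.
Local Open Scope ring_scope.

Section iid_law.
Context d (T : measurableType d) (R : realType) (S : probability T R).

Definition cons_pair n (p : T * n.-tuple T) : n.+1.-tuple T :=
  [the n.+1.-tuple T of p.1 :: p.2].

Lemma measurable_cons_pair n : measurable_fun [set: T * n.-tuple T] (@cons_pair n).
Proof. exact: measurable_cons. Qed.

HB.instance Definition _ n :=
  isMeasurableFun.Build _ _ _ _ (@cons_pair n) (@measurable_cons_pair n).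

(* The n-fold product S^n, i.e. the joint law of n independent draws from S;
   [iid_lawE] below is its characteristic property. *)
Fixpoint iid_law n : probability (n.-tuple T) R :=
  match n with
  | 0 => \d_([tuple] : 0.-tuple T)
  | k.+1 => distribution (S \x iid_law k)%E (@cons_pair k)
  end.

Lemma measurable_box n (A : 'I_n -> set T) : (forall i, measurable (A i)) ->
  measurable [set z : n.-tuple T | forall i, A i (tnth z i)].
Proof.
move=> mA.
rewrite (_ : [set z | _] =
    \bigcap_(i in [set: 'I_n]) ((@tnth n T)^~ i @^-1` A i)); last first.
  by apply/seteqP; split=> z /= zA i; [move=> _; exact: zA|exact: zA].
apply: fin_bigcap_measurable => // i _.
by rewrite -[X in measurable X]setTI; exact: (measurable_tnth i _ (mA i)).
Qed.

Lemma iid_lawE n (A : 'I_n -> set T) : (forall i, measurable (A i)) ->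
  iid_law n [set z | forall i, A i (tnth z i)] = (\prod_(i < n) S (A i))%E.
Proof.
elim: n A => [|n ih] A mA /=.
  by rewrite big_ord0 diracE mem_set// => -[].
rewrite big_ord_recl -ih// /distribution /pushforward/=.
rewrite -(product_measure1E S (iid_law n))//;
  last exact: (@measurable_box n (fun j => A (lift ord0 j))).
congr (_ _); apply/seteqP; split=> [[x z]|[x z]] /=.
  move=> zA; split; first exact: (zA ord0).
  by move=> i; have := zA (lift ord0 i); rewrite tnthS.
move=> [xA zA] i; case: (unliftP ord0 i) => [j|] ->; last exact: xA.
by rewrite tnthS; exact: zA.
Qed.

End iid_law.

Section dual_learning.
Context d1 d2 (X : measurableType d1) (Y : measurableType d2) (R : realType).
Variables (l1 : Y -> Y -> R) (l2 : X -> X -> R).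

Definition dual_loss (h : (X -> Y) * (Y -> X)) (z : X * Y) : R :=
  l1 (h.1 z.1) z.2 + l2 (h.2 (h.1 z.1)) z.1.

Definition expected_loss (S : probability (X * Y)%type R)
    (h : (X -> Y) * (Y -> X)) : R :=
  fine 'E_S[dual_loss h]%E.

Definition empirical_loss m (Z : m.-tuple (X * Y)) (h : (X -> Y) * (Y -> X)) : R :=
  m%:R^-1 * \sum_(i < m) dual_loss h (tnth Z i).

(* The sign sigma_i is encoded by the boolean s i as (-1) ^+ s i. *)
Definition rademacher_sup (H : set ((X -> Y) * (Y -> X))) m
    (s : {ffun 'I_m -> bool}) (Z : m.-tuple (X * Y)) : R :=
  sup [set m%:R^-1 * \sum_(i < m) (-1) ^+ s i * dual_loss h (tnth Z i) | h in H].

(* The law of m independent uniform signs is uniform on the 2 ^ m sign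
   patterns, so the expectation over sigma is a finite average. *)
Definition empirical_rademacher (H : set ((X -> Y) * (Y -> X))) m
    (Z : m.-tuple (X * Y)) : R :=
  (2 ^+ m)^-1 * \sum_(s : {ffun 'I_m -> bool}) rademacher_sup H s Z.

Definition rademacher (S : probability (X * Y)%type R)
    (H : set ((X -> Y) * (Y -> X))) (m : nat) : R :=
  fine 'E_(iid_law S m)[@empirical_rademacher H m]%E.

(* Used only to state measurability of the events
   {for all h in H, E h <= Ehat h + c}, which are its sublevel sets. *)
Definition uniform_deviation (S : probability (X * Y)%type R)
    (H : set ((X -> Y) * (Y -> X))) m (Z : m.-tuple (X * Y)) : R :=
  sup [set expected_loss S h - empirical_loss Z h | h in H].

End dual_learning.

(* Main.v *)
(* For part (i), let Phi be the supremum over H of the expected minus the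
   empirical loss. It moves by at most M/m when one sample point changes, so
   McDiarmid's inequality bounds it by its mean plus the deviation term, and
   symmetrization bounds that mean by twice the Rademacher complexity. For part
   (ii), McDiarmid is applied once, to Phi minus twice the empirical Rademacher
   complexity: its differences are bounded by 3M/m and its mean is nonpositive,
   which gives log(1/delta) rather than the log(2/delta) of a union bound. *)
Require Import Defs.
From mathcomp Require Import all_boot all_order all_algebra.
From mathcomp Require Import all_classical all_reals all_analysis.
From mathcomp Require Import measurable_realfun ring lra.

Set Implicit Arguments.
Unset Strict Implicit.
Unset Printing Implicit Defensive.

Import Order.TTheory GRing.Theory Num.Theory.
Import numFieldNormedType.Exports.

Local Open Scope classical_set_scope.
Local Open Scope ring_scope.

Lemma probability_setT_nonempty d (T : measurableType d) (R : realType)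
  (P : probability T R) : [set: T] !=set0.
Proof.
apply/set0P/eqP => T0; have := probability_setT P.
by rewrite T0 measure0 => -[/esym/eqP]; rewrite oner_eq0.
Qed.

(** * Calculus behind Hoeffding's lemma *)

Lemma ge0_is_derive_le (R : realType) (f df : R -> R) :
  (forall x : R, is_derive x 1 f (df x)) -> (forall x, 0 <= x -> 0 <= df x) ->
  forall x, 0 <= x -> f 0 <= f x.
Proof.
move=> fdf df0 x x0.
have [|c] := @MVT_segment R f df 0 x x0 (fun y _ => fdf y).
  apply: continuous_subspaceT => y.
  by apply/differentiable_continuous/derivable1_diffP; have [] := fdf y.
rewrite in_itv/= => /andP[c0 _] fE.
by rewrite -subr_ge0 fE mulr_ge0 ?subr_ge0// df0.
Qed.

(** Convexity of the exponential between 0 and [h]: averaging two tangent-line inequalities with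
    weights [t] and [1 - t] cancels the slope terms. *)
Lemma expR_le_chord (R : realType) (t h : R) : 0 <= t <= 1 ->
  expR (t * h) <= 1 - t + t * expR h.
Proof.
move=> /andP[t0 t1].
(* Tangent line at [t * h], evaluated at [h] and at [0]. *)
have E (x : R) : expR (t * h) * (1 + (x - t * h)) <= expR x.
  rewrite -{2}(subrKC (t * h) x) expRD ler_pM2l ?expR_gt0//.
  exact: expR_ge1Dx.
have := E h; have := E 0; rewrite expR0.
by nra.
Qed.

(** The gap [psi] between the exponent on the right and the log of the left side vanishes at 0
    together with its derivative [dpsi], and its second derivative is nonnegative; two monotonicity
    arguments then give [0 <= psi h]. *)
Lemma bernoulli_mgf_le (R : realType) (p h : R) : 0 <= p <= 1 -> 0 <= h ->
  1 - p + p * expR h <= expR (p * h + h ^+ 2 / 8).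
Proof.
move=> /andP[p0 p1] h0.
pose G (x : R) := 1 - p + p * expR x.
have G0 x : 0 < G x.
  rewrite /G; have [->|pn0] := eqVneq p 0; first by rewrite mul0r; lra.
  rewrite addrC ltr_wpDr ?subr_ge0// mulr_gt0 ?expR_gt0//.
  by rewrite lt_neqAle eq_sym pn0.
have dG (x : R) : is_derive x 1 G (p * expR x).
  have -> : G = cst (1 - p) + p \*: @expR R by [].
  by apply: is_derive_eq; rewrite add0r.
(* [u x] is the mean of the Bernoulli law tilted by [expR x], and its derivative [u x * (1 - u x)]
   is the variance of that law. *)
pose u (x : R) := p * expR x * (G x)^-1.
pose psi (x : R) := p * x + x ^+ 2 / 8 - ln (G x).
pose dpsi (x : R) := p + x / 4 - u x.
have du (x : R) : is_derive x 1 u (u x * (1 - u x)).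
  have := G0 x => /lt0r_neq0 Gn0.
  have dV := is_deriveV Gn0 (dG x).
  suff : is_derive x 1 ((p \*: @expR R) * (fun y => (G y)^-1))
    (u x * (1 - u x)) by [].
  apply: is_derive_eq.
  rewrite /u/= /GRing.scale/=.
  by move: Gn0; rewrite /G => Gn0; field.
have ddpsi (x : R) : is_derive x 1 dpsi (4^-1 - u x * (1 - u x)).
  have -> : dpsi = cst p + 4^-1 \*: @id R - u.
    by apply/funext => y; rewrite /dpsi mulrC.
  by apply: is_derive_eq; rewrite /GRing.scale/=; ring.
have dpsi0 (x : R) : 0 <= x -> 0 <= dpsi x.
  move=> x0; have <- : dpsi 0 = 0.
    by rewrite /dpsi /u /G expR0 mulr1 subrK invr1 mulr1 mul0r addr0 subrr.
  apply: ge0_is_derive_le x0 => [y _].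
  (* A Bernoulli variance is at most 1/4: the difference is the square of [u y - 2^-1]. This is the
     source of the constant 8. *)
  by have := sqr_ge0 (u y - 2^-1); nra.
have dpsiE (x : R) : is_derive x 1 psi (dpsi x).
  have := is_derive1_ln (G0 x) => dln.
  have -> : psi = p \*: @id R + 8^-1 \*: (@id R) ^+ 2 - (@ln R \o G).
    by apply/funext => y; rewrite /psi [_ / 8]mulrC.
  apply: is_derive_eq.
  by rewrite /dpsi /u /GRing.scale/=; field; rewrite lt0r_neq0.
have := ge0_is_derive_le dpsiE dpsi0 h0.
rewrite {1}/psi /G expR0 mulr1 subrK ln1 mulr0 expr0n/= mul0r addr0 subr0.
by rewrite subr_ge0 -ler_expR lnK// posrE.
Qed.

(** * Bounded measurable functions and their means *)

Section bounded_measurable.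
Context d (T : measurableType d) (R : realType).

(** A class closed under the operations below and integrable for every probability, so that
    integrability side conditions reduce to closure lemmas. *)
Definition bounded_measurable (f : T -> R) :=
  measurable_fun [set: T] f /\ exists K, forall x, `|f x| <= K.

Lemma bounded_measurable_cst c : bounded_measurable (fun=> c).
Proof. by split; [exact: measurable_cst|exists `|c|]. Qed.

Lemma bounded_measurableD f g : bounded_measurable f -> bounded_measurable g ->
  bounded_measurable (fun x => f x + g x).
Proof.
move=> [mf [K fK]] [mg [L gL]]; split; first exact: measurable_funD.
by exists (K + L) => x; rewrite (le_trans (ler_normD _ _))// lerD.
Qed.

Lemma bounded_measurableM f g : bounded_measurable f -> bounded_measurable g ->
  bounded_measurable (fun x => f x * g x).
Proof.
move=> [mf [K fK]] [mg [L gL]]; split; first exact: measurable_funM.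
by exists (K * L) => x; rewrite normrM ler_pM.
Qed.

Lemma bounded_measurableZ c f : bounded_measurable f ->
  bounded_measurable (fun x => c * f x).
Proof. exact/bounded_measurableM/bounded_measurable_cst. Qed.

Lemma bounded_measurableB f g : bounded_measurable f -> bounded_measurable g ->
  bounded_measurable (fun x => f x - g x).
Proof.
move=> bf bg; under eq_fun do rewrite -mulN1r.
exact: bounded_measurableD (bounded_measurableZ _ _).
Qed.

Lemma bounded_measurable_sum (I : Type) (r : seq I) (f : I -> T -> R) :
  (forall i, bounded_measurable (f i)) ->
  bounded_measurable (fun x => \sum_(i <- r) f i x).
Proof.
move=> bf; elim: r => [|i r ih].
  by under eq_fun do rewrite big_nil; exact: bounded_measurable_cst.
by under eq_fun do rewrite big_cons; exact: bounded_measurableD.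
Qed.

Lemma bounded_measurable_expR f : bounded_measurable f ->
  bounded_measurable (fun x => expR (f x)).
Proof.
move=> [mf [K fK]]; split; first exact: measurableT_comp.
exists (expR K) => x; rewrite ger0_norm ?expR_ge0// ler_expR.
exact: le_trans (ler_norm _) (fK x).
Qed.

Lemma bounded_measurable_indic (A : set T) : measurable A ->
  bounded_measurable (\1_A : T -> R).
Proof.
move=> mA; split; first exact: measurable_indic.
by exists 1 => x; rewrite indicE ger0_norm ?ler0n// lern1 leq_b1.
Qed.

Variable P : probability T R.
Implicit Types f g : T -> R.

Lemma bounded_measurable_integrable f : bounded_measurable f ->
  P.-integrable [set: T] (EFin \o f).
Proof.
move=> [mf [K fK]]; apply: measurable_bounded_integrable => //.
- exact: le_lt_trans (probability_le1 P measurableT) (ltry _).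
- exists K; split; first exact: num_real.
  by move=> y Ky x _ /=; exact: le_trans (fK x) (ltW Ky).
Qed.
#[local] Hint Resolve bounded_measurable_integrable : core.

Lemma mean_cst c : \int[P]_x c = c.
Proof.
rewrite Rintegral_cst// -[RHS]mulr1; congr (_ * _).
exact: (congr1 fine (probability_setT P)).
Qed.

Lemma le_mean f g : bounded_measurable f -> bounded_measurable g ->
  (forall x, f x <= g x) -> \int[P]_x f x <= \int[P]_x g x.
Proof. by move=> bf bg fg; apply: le_Rintegral => //; auto. Qed.

Lemma meanD f g : bounded_measurable f -> bounded_measurable g ->
  \int[P]_x (f x + g x) = \int[P]_x f x + \int[P]_x g x.
Proof. by move=> bf bg; rewrite RintegralD//; auto. Qed.

Lemma meanB f g : bounded_measurable f -> bounded_measurable g ->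
  \int[P]_x (f x - g x) = \int[P]_x f x - \int[P]_x g x.
Proof. by move=> bf bg; rewrite RintegralB//; auto. Qed.

Lemma meanZ c f : bounded_measurable f ->
  \int[P]_x (c * f x) = c * \int[P]_x f x.
Proof. by move=> bf; rewrite RintegralZl//; auto. Qed.

Lemma mean_sum (I : Type) (r : seq I) (f : I -> T -> R) :
  (forall i, bounded_measurable (f i)) ->
  \int[P]_x (\sum_(i <- r) f i x) = \sum_(i <- r) \int[P]_x f i x.
Proof.
move=> bf; elim: r => [|i r ih].
  under eq_Rintegral do rewrite big_nil.
  by rewrite mean_cst big_nil.
under eq_Rintegral do rewrite big_cons.
by rewrite meanD// ?ih ?big_cons//; exact: bounded_measurable_sum.
Qed.

Lemma norm_mean_le f (K : R) :
  bounded_measurable f -> (forall x, `|f x| <= K) ->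
  `|\int[P]_x f x| <= K.
Proof.
move=> bf fK; rewrite ler_norml -[leLHS]mean_cst -[in X in _ && X](mean_cst K).
by apply/andP; split; apply: le_mean => //;
  [exact: bounded_measurable_cst| |exact: bounded_measurable_cst|];
  move=> x; have := fK x; rewrite ler_norml => /andP[].
Qed.

Lemma EFin_mean f : bounded_measurable f ->
  (\int[P]_x f x)%:E = (\int[P]_x (f x)%:E)%E.
Proof.
move=> bf; rewrite fineK//.
by apply: integrable_fin_num => //; exact: bounded_measurable_integrable.
Qed.

Lemma mean_indic (A : set T) : measurable A -> \int[P]_x \1_A x = fine (P A).
Proof. by move=> mA; rewrite /Rintegral integral_indic// setIT. Qed.

End bounded_measurable.

Lemma bounded_measurable_comp d d' (T : measurableType d)
    (T' : measurableType d') (R : realType) (f : T -> R) (g : T' -> T) :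
  bounded_measurable f -> measurable_fun [set: T'] g ->
  bounded_measurable (f \o g).
Proof.
move=> [mf [K fK]] mg; split; first exact: measurableT_comp.
by exists K => x; exact: fK.
Qed.

(** * Fubini's theorem for bounded measurable functions *)

Section fubini.
Context d1 d2 (T1 : measurableType d1) (T2 : measurableType d2) (R : realType).
Variables (P : probability T1 R) (Q : probability T2 R) (f : T1 * T2 -> R).
Hypothesis bf : bounded_measurable f.

Let intf : (P \x Q)%E.-integrable [set: T1 * T2] (EFin \o f).
Proof. exact: bounded_measurable_integrable. Qed.

Lemma bounded_measurable_pair1 x : bounded_measurable (fun y => f (x, y)).
Proof. by apply: (bounded_measurable_comp bf (g := pair x)). Qed.

Lemma bounded_measurable_pair2 y : bounded_measurable (fun x => f (x, y)).
Proof. by apply: (bounded_measurable_comp bf (g := pair^~ y)). Qed.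

(** Partial means stay in the class, which lets iterated means be handled by the same lemmas. *)
Lemma bounded_measurable_mean1 :
  bounded_measurable (fun x => \int[Q]_y f (x, y)).
Proof.
split.
  apply/measurable_EFinP.
  rewrite (_ : _ \o _ = fubini_F Q (EFin \o f)).
    exact: measurable_fubini_F intf.
  by apply/funext => x/=; rewrite EFin_mean//; exact: bounded_measurable_pair1.
have [_ [K fK]] := bf; exists K => x.
by apply: norm_mean_le => //; exact: bounded_measurable_pair1.
Qed.

Lemma mean_prod : \int[(P \x Q)%E]_z f z = \int[P]_x \int[Q]_y f (x, y).
Proof.
rewrite /Rintegral -(integral12_prod_meas1 intf)//; congr fine.
apply: eq_integral => x _.
by rewrite [RHS]EFin_mean//; exact: bounded_measurable_pair1.
Qed.

Lemma mean_swap :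
  \int[P]_x \int[Q]_y f (x, y) = \int[Q]_y \int[P]_x f (x, y).
Proof.
rewrite -mean_prod /Rintegral -(integral21_prod_meas1 intf)//; congr fine.
apply: eq_integral => y _.
by rewrite [RHS]EFin_mean//; exact: bounded_measurable_pair2.
Qed.

End fubini.

(** * Hoeffding's lemma *)

Section hoeffding.
Context d (T : measurableType d) (R : realType) (P : probability T R).

(** After rescaling [g] to [0, 1], the chord bound replaces it by a Bernoulli variable with the same
    mean. The hypothesis bounds the oscillation of [g] without naming an interval, the form in which
    bounded differences supply it. *)
Lemma hoeffding_mgf (g : T -> R) (c lam : R) : bounded_measurable g ->
  (forall x y, g x <= g y + c) -> 0 <= lam ->
  \int[P]_x expR (lam * (g x - \int[P]_y g y)) <= expR (lam ^+ 2 * c ^+ 2 / 8).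
Proof.
move=> bg gc lam0.
set mu := \int[P]_y g y.
have [t _] := probability_setT_nonempty P.
have : 0 <= c by have := gc t t; lra.
rewrite le0r => /predU1P[c0|c0].
(* Here [g] is constant; the case is separate because the rescaling divides by [c]. *)
- have gE x : g x = g t.
    apply: le_anti; have := gc x t; have := gc t x.
    by rewrite c0 !addr0 => -> ->.
  have -> : mu = g t.
    by rewrite /mu; under eq_Rintegral do rewrite gE; rewrite mean_cst.
  under eq_Rintegral do rewrite gE subrr mulr0 expR0.
  by rewrite mean_cst c0 expr0n/= mulr0 mul0r expR0.
(* All values of [g], hence also its mean, lie between [a] and [a + c]. *)
- pose a := inf (range g).
  have rg0 : range g !=set0 by exists (g t), t.
  have ag x : a <= g x.
    apply: inf_lbound; last by exists x.
    by exists (g t - c) => _ [y _ <-]; rewrite lerBlDr.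
  have ga x : g x <= a + c.
    rewrite -lerBlDr; apply: lb_le_inf => // _ [y _ <-].
    by rewrite lerBlDr.
  have bc := @bounded_measurable_cst _ T R.
  have mua : a <= mu by rewrite -(mean_cst P a); apply: le_mean.
  have muc : mu <= a + c by rewrite -[leRHS](mean_cst P); apply: le_mean.
  pose u x := (g x - a) / c.
  have u01 x : 0 <= u x <= 1.
    by rewrite /u divr_ge0 ?subr_ge0 ?(ltW c0)//= ler_pdivrMr// mul1r lerBlDl.
  have bu : bounded_measurable u.
    rewrite /u; under eq_fun do rewrite mulrC.
    exact/bounded_measurableZ/bounded_measurableB.
  pose p := (mu - a) / c.
  have p01 : 0 <= p <= 1.
    by rewrite /p divr_ge0 ?subr_ge0 ?(ltW c0)//= ler_pdivrMr// mul1r lerBlDl.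
  have mu_u : \int[P]_x u x = p.
    rewrite /u; under eq_Rintegral do rewrite mulrC.
    rewrite meanZ; last exact: bounded_measurableB.
    by rewrite meanB// mean_cst mulrC.
  (* The centred exponent equals [(u x - p) * (lam * c)], whose [p] part is a constant factor. *)
  have -> : (fun x => expR (lam * (g x - mu))) =
      (fun x => expR (- (p * (lam * c))) * expR (u x * (lam * c))).
    apply/funext => x; rewrite -expRD; congr expR.
    by rewrite /u /p; field; rewrite gt_eqF.
  have be : bounded_measurable (fun x => expR (u x * (lam * c))).
    apply: bounded_measurable_expR; under eq_fun do rewrite mulrC.
    exact: bounded_measurableZ.
  rewrite meanZ// expRN mulrC ler_pdivrMr ?expR_gt0// -expRD.
  have bch : bounded_measurable (fun x => 1 + (expR (lam * c) - 1) * u x).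
    by apply: bounded_measurableD => //; exact: bounded_measurableZ.
  apply: (@le_trans _ _ (\int[P]_x (1 + (expR (lam * c) - 1) * u x))).
    apply: le_mean => // x; apply: le_trans (expR_le_chord _ (u01 x)) _.
    by lra.
  rewrite meanD//; last exact: bounded_measurableZ.
  rewrite mean_cst meanZ// mu_u.
  have -> : 1 + (expR (lam * c) - 1) * p = 1 - p + p * expR (lam * c) by ring.
  apply: le_trans (bernoulli_mgf_le p01 _) _.
    by rewrite mulr_ge0// ltW.
  by rewrite exprMn addrC.
Qed.

End hoeffding.

(** * Independent samples and exchange with a ghost sample *)

Section iid.
Context d (T : measurableType d) (R : realType) (S : probability T R).

Lemma bounded_measurable_cons_pair n (f : n.+1.-tuple T -> R) :
  bounded_measurable f -> bounded_measurable (f \o @cons_pair d T n).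
Proof.
by move=> bf; apply: (bounded_measurable_comp bf);
  exact: measurable_cons_pair.
Qed.

Lemma bounded_measurable_cons n (f : n.+1.-tuple T -> R) z :
  bounded_measurable f -> bounded_measurable (fun Z => f (cons_pair (z, Z))).
Proof.
by move=> /bounded_measurable_cons_pair /bounded_measurable_pair1; exact.
Qed.

Lemma mean_iidS n (f : n.+1.-tuple T -> R) : bounded_measurable f ->
  \int[iid_law S n.+1]_Z f Z =
  \int[S]_z \int[iid_law S n]_Z f (cons_pair (z, Z)).
Proof.
move=> bf; have bfc := bounded_measurable_cons_pair bf.
rewrite -(mean_prod _ _ bfc).
rewrite /Rintegral/= integral_distribution//.
- by apply/measurable_EFinP; case: bf.
- exact: bounded_measurable_integrable.
Qed.

Lemma mean_iid_tnth n (i : 'I_n) (g : T -> R) : bounded_measurable g ->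
  \int[iid_law S n]_Z g (tnth Z i) = \int[S]_z g z.
Proof.
move=> bg; elim: n i => [[]//|n ih] i.
rewrite mean_iidS; last first.
  by apply: (bounded_measurable_comp bg); exact: measurable_tnth.
case: (unliftP ord0 i) => [j|] ->.
  under eq_Rintegral do under eq_Rintegral do rewrite /cons_pair/= tnthS.
  by under eq_Rintegral do rewrite ih; rewrite mean_cst.
by apply: eq_Rintegral => z _; exact: (mean_cst (iid_law S n) (g z)).
Qed.

(** Recombines a sample with a ghost sample: the true positions of [s] are taken from [Z']. *)
Definition mix n (s : 'I_n -> bool) (Z Z' : n.-tuple T) : n.-tuple T :=
  [tuple if s i then tnth Z' i else tnth Z i | i < n].

Lemma mix_cons n (s : 'I_n.+1 -> bool) z z' (Z Z' : n.-tuple T) :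
  mix s (cons_pair (z, Z)) (cons_pair (z', Z')) =
  cons_pair (if s ord0 then z' else z, mix (s \o lift ord0) Z Z').
Proof.
apply: eq_from_tnth => i; rewrite tnth_mktuple.
case: (unliftP ord0 i) => [j|] ->; last by case: (s ord0).
by rewrite /cons_pair/= !tnthS tnth_mktuple.
Qed.

Lemma measurable_mix n (s : 'I_n -> bool) :
  measurable_fun setT (fun p : n.-tuple T * n.-tuple T => mix s p.1 p.2).
Proof.
apply/measurable_fun_tnthP => i /=.
rewrite (_ : _ \o _ = fun p => if s i then tnth p.2 i else tnth p.1 i).
  by case: (s i); apply: measurableT_comp (measurable_tnth i) _.
by apply/funext => p /=; rewrite tnth_mktuple.
Qed.

Lemma bounded_measurable_mix n (s : 'I_n -> bool) (f : n.-tuple T -> R) :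
  bounded_measurable f ->
  bounded_measurable (fun p : n.-tuple T * n.-tuple T => f (mix s p.1 p.2)).
Proof.
by move=> bf; apply: (bounded_measurable_comp bf);
  exact: measurable_mix.
Qed.

(** The coordinates of both samples are independent with common law [S], so any coordinatewise
    selection again has law [iid_law S n]. The induction splits off the first point of each
    sample. *)
Lemma mean_mix n (s : 'I_n -> bool) (f : n.-tuple T -> R) :
  bounded_measurable f ->
  \int[iid_law S n]_Z \int[iid_law S n]_Z' f (mix s Z Z') =
  \int[iid_law S n]_Z f Z.
Proof.
elim: n s f => [|n ih] s f bf.
  have fE Z : f Z = f [tuple] by rewrite [Z]tuple0.
  under eq_Rintegral do under eq_Rintegral do rewrite fE.
  under [RHS]eq_Rintegral do rewrite fE.
  by under eq_Rintegral do rewrite mean_cst.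
have bm := bounded_measurable_mix s bf.
rewrite mean_iidS; last exact: (bounded_measurable_mean1 (iid_law S n.+1) _ bm).
rewrite [RHS]mean_iidS//.
pose s' := s \o lift ord0.
transitivity (\int[S]_z \int[iid_law S n]_Z \int[S]_z' \int[iid_law S n]_Z'
    f (cons_pair (if s ord0 then z' else z, mix s' Z Z'))).
  apply: eq_Rintegral => z _; apply: eq_Rintegral => Z _.
  rewrite mean_iidS; last exact: bounded_measurable_pair1 bm _.
  by under eq_Rintegral do under eq_Rintegral do rewrite mix_cons.
have IH z : \int[iid_law S n]_Z \int[iid_law S n]_Z'
    f (cons_pair (z, mix s' Z Z')) = \int[iid_law S n]_Z f (cons_pair (z, Z)).
  exact: (ih s' _ (bounded_measurable_cons z bf)).
(* If the head comes from the first sample, [z'] is idle and integrates away. *)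
case: (s ord0) => /=; last first.
  apply: eq_Rintegral => z _; rewrite -IH.
  by apply: eq_Rintegral => Z _; rewrite mean_cst.
(* If the head comes from the ghost sample, [z] is idle, and [z'] must be moved outside [Z]. The
   grouping in [F] makes [Z'] the inner variable, so that Fubini swaps [Z] and [z']. *)
pose F (q : (n.-tuple T * T) * n.-tuple T) :=
  f (cons_pair (q.1.2, mix s' q.1.1 q.2)).
have bF : bounded_measurable F.
  apply: (bounded_measurable_comp bf).
  apply: measurable_cons.
    exact: measurableT_comp measurable_snd measurable_fst.
  apply: (measurableT_comp (measurable_mix s')
    (g := fun q : (n.-tuple T * T) * n.-tuple T => (q.1.1, q.2))).
  by apply: measurable_fun_pair => //;
    exact: measurableT_comp measurable_fst measurable_fst.
rewrite mean_cst.
apply: etrans (mean_swap _ _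
  (bounded_measurable_mean1 (iid_law S n \x S)%E (iid_law S n) bF)) _.
by apply: eq_Rintegral => z _; exact: IH.
Qed.


End iid.

(** * McDiarmid's inequality *)

Section mcdiarmid.
Context d (T : measurableType d) (R : realType) (S : probability T R).

(** The one-sided bound is already two-sided, since [Z] and [Z'] may be exchanged. *)
Definition bounded_differences n (c : R) (f : n.-tuple T -> R) :=
  forall i Z Z', (forall j, j != i -> tnth Z j = tnth Z' j) -> f Z <= f Z' + c.

Lemma bounded_differences_cons n c (f : n.+1.-tuple T -> R) z :
  bounded_differences c f ->
  bounded_differences c (fun Z => f (cons_pair (z, Z))).
Proof.
move=> fc i Z Z' ZZ'; apply: (fc (lift ord0 i)) => j.
case: (unliftP ord0 j) => [k|] -> //.
by rewrite (inj_eq lift_inj) /cons_pair/= !tnthS; exact: ZZ'.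
Qed.

Lemma bounded_differences_head n c (f : n.+1.-tuple T -> R) z z' Z :
  bounded_differences c f -> f (cons_pair (z, Z)) <= f (cons_pair (z', Z)) + c.
Proof.
move=> fc; apply: (fc ord0) => j.
by case: (unliftP ord0 j) => [k|] -> //; rewrite ?eqxx// /cons_pair/= !tnthS.
Qed.

Lemma cons_pair_eta n (Z : n.+1.-tuple T) : exists z Z', Z = cons_pair (z, Z').
Proof. by case/tupleP: Z => z Z'; exists z, Z'; exact: val_inj. Qed.

(** Changes the coordinates one at a time. It serves the degenerate case [c = 0], where it makes [f]
    constant. *)
Lemma bounded_differences_le n c (f : n.-tuple T -> R) Z Z' :
  bounded_differences c f -> f Z <= f Z' + c * n%:R.
Proof.
elim: n f Z Z' => [|n ih] f Z Z' fc.
  by rewrite [Z]tuple0 [Z']tuple0 mulr0 addr0.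
have [z [W ->]] := cons_pair_eta Z; have [z' [W' ->]] := cons_pair_eta Z'.
apply: le_trans (bounded_differences_head z z' W fc) _.
rewrite -natr1 mulrDr mulr1 addrA lerD2r.
exact: ih (bounded_differences_cons z' fc).
Qed.

(** The martingale argument as an induction: conditionally on the first point, the deviation of [f]
    from its conditional mean [g] is controlled by the induction hypothesis, and that of [g] from
    [mu] by Hoeffding's lemma. *)
Lemma mcdiarmid_mgf n c (f : n.-tuple T -> R) lam :
  bounded_measurable f -> bounded_differences c f -> 0 <= lam ->
  \int[iid_law S n]_Z expR (lam * (f Z - \int[iid_law S n]_Z' f Z')) <=
  expR (n%:R * (lam ^+ 2 * c ^+ 2 / 8)).
Proof.
move=> + + lam0; elim: n f => [|n ih] f bf fc.
  have fE Z : f Z = f [tuple] by rewrite [Z]tuple0.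
  rewrite (_ : Rintegral _ _ f = f [tuple]); last first.
    by under eq_Rintegral do rewrite fE; exact: mean_cst.
  under eq_Rintegral do rewrite fE subrr mulr0 expR0.
  by rewrite mean_cst mul0r expR0.
set mu := Rintegral _ _ f.
pose g z := \int[iid_law S n]_Z f (cons_pair (z, Z)).
have bfc z := bounded_measurable_cons z bf.
have bg : bounded_measurable g.
  exact: (bounded_measurable_mean1 S _ (bounded_measurable_cons_pair bf)).
have muE : mu = \int[S]_z g z by rewrite /mu mean_iidS.
have be (h : n.+1.-tuple T -> R) a : bounded_measurable h ->
    bounded_measurable (fun Z => expR (lam * (h Z - a))).
  move=> bh; apply/bounded_measurable_expR/bounded_measurableZ.
  exact/bounded_measurableB/bounded_measurable_cst.
rewrite mean_iidS; last exact: be.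
set K := expR (n%:R * (lam ^+ 2 * c ^+ 2 / 8)).
have beg : bounded_measurable (fun z => expR (lam * (g z - mu))).
  apply/bounded_measurable_expR/bounded_measurableZ.
  exact/bounded_measurableB/bounded_measurable_cst.
apply: (@le_trans _ _ (\int[S]_z (K * expR (lam * (g z - mu))))).
  apply: le_mean.
  - exact: (bounded_measurable_mean1 S _
      (bounded_measurable_cons_pair (be _ mu bf))).
  - exact: bounded_measurableZ.
  move=> z.
  have -> : (fun Z => expR (lam * (f (cons_pair (z, Z)) - mu))) =
      (fun Z => expR (lam * (g z - mu)) *
                expR (lam * (f (cons_pair (z, Z)) - g z))).
    by apply/funext => Z; rewrite -expRD; congr expR; ring.
  rewrite meanZ; last first.
    apply/bounded_measurable_expR/bounded_measurableZ.
    exact/bounded_measurableB/bounded_measurable_cst.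
  rewrite mulrC ler_pM2r ?expR_gt0//.
  exact: ih (bounded_differences_cons z fc).
rewrite meanZ// -natr1 mulrDl mul1r expRD ler_pM2l ?expR_gt0// muE.
apply: hoeffding_mgf => // z z'.
(* [g] oscillates by at most [c], by averaging the bound for a change of the first point. *)
rewrite /g -[in leRHS](mean_cst (iid_law S n) c) -meanD//;
  last exact: bounded_measurable_cst.
apply: le_mean => //.
  by apply: bounded_measurableD => //; exact: bounded_measurable_cst.
by move=> Z; exact: bounded_differences_head.
Qed.

Lemma measurable_le_cst n (f : n.-tuple T -> R) a : measurable_fun setT f ->
  measurable [set Z | f Z <= a].
Proof.
move=> mf; rewrite -[X in measurable X]setTI.
rewrite (_ : [set _ | _] = f @^-1` `]-oo, a]%classic); first exact: mf.
by apply/seteqP; split => Z /=; rewrite in_itv.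
Qed.

(** Chernoff's method: the exponential moment bound is used at the optimal [lam], and the deviation
    is chosen so that the failure probability is at most [delta]. *)
Lemma mcdiarmid n c (f : n.-tuple T -> R) delta : (0 < n)%N -> 0 <= c ->
  bounded_measurable f -> bounded_differences c f -> 0 < delta ->
  ((1 - delta)%:E <= iid_law S n [set Z | (f Z <= \int[iid_law S n]_Z' f Z'
    + n%:R * c * Num.sqrt (1 / (2 * n%:R) * ln (1 / delta)))%R])%E.
Proof.
move=> n0 c0 bf fc d0.
set mu := Rintegral _ _ f; set s := Num.sqrt _; set A := [set Z | _].
have nR0 : 0 < n%:R :> R by rewrite ltr0n.
have [d1|d1] := leP 1 delta.
  by apply: le_trans (measure_ge0 _ _); rewrite lee_fin subr_le0.
have mA : measurable A by apply: measurable_le_cst; case: bf.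
(* The radicand is nonnegative because [delta < 1] from here on. *)
have s2 : s ^+ 2 = 1 / (2 * n%:R) * ln (1 / delta).
  rewrite sqr_sqrtr// mulr_ge0//.
  by rewrite ln_ge0// div1r invf_ge1// ltW.
move: c0; rewrite le_eqVlt => /predU1P[c0|c0].
  have -> : A = setT.
    apply/seteqP; split => // Z _; rewrite /A/= -c0 mulr0 mul0r addr0.
    rewrite -(mean_cst (iid_law S n) (f Z)).
    apply: le_mean => //; first exact: bounded_measurable_cst.
    move=> Z'; have := bounded_differences_le Z Z' fc.
    by rewrite -c0 mul0r addr0.
  by rewrite probability_setT lee_fin gerBl ltW.
(* The minimizer of [- (lam * t) + n%:R * (lam ^+ 2 * c ^+ 2 / 8)] for the deviation [t] below; it
   requires [c] nonzero. *)
pose lam := 4 * s / c.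
have lam0 : 0 <= lam by rewrite divr_ge0 ?mulr_ge0 ?sqrtr_ge0// ltW.
pose t := n%:R * c * s.
have be : bounded_measurable (fun Z => expR (lam * (f Z - mu))).
  apply/bounded_measurable_expR/bounded_measurableZ.
  exact/bounded_measurableB/bounded_measurable_cst.
have chernoff : fine (iid_law S n (~` A)) <= delta.
  rewrite -mean_indic; last exact: measurableC.
  (* Markov's inequality: on the failure event [f Z - mu] exceeds [t], so the exponential dominates
     the indicator. *)
  apply: (@le_trans _ _
      (\int[iid_law S n]_Z (expR (- (lam * t)) * expR (lam * (f Z - mu))))).
    apply: le_mean.
    - exact/bounded_measurable_indic/measurableC.
    - exact: bounded_measurableZ.
    move=> Z; rewrite -expRD -mulrN -mulrDr indicE.
    have [ZA|_] := boolP (Z \in ~` A); last exact: expR_ge0.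
    rewrite -expR0 ler_expR mulr_ge0//.
    move: ZA; rewrite inE /A /= => /negP; rewrite -ltNge -/t => ft.
    by lra.
  rewrite meanZ//.
  apply: le_trans (ler_wpM2l (expR_ge0 _) (mcdiarmid_mgf bf fc lam0)) _.
  rewrite -expRD -[leRHS]lnK ?posrE// ler_expR.
  (* At the optimum the exponent is [- (2 * n%:R * s ^+ 2)], which is [ln delta] by the choice of
     [s]. *)
  have -> : - (lam * t) + n%:R * (lam ^+ 2 * c ^+ 2 / 8) =
      - (2 * n%:R * s ^+ 2).
    by rewrite /lam /t; field; rewrite gt_eqF.
  rewrite s2 !div1r lnV ?posrE// mulrN mulrN opprK.
  by rewrite mulVKf// gt_eqF// mulr_gt0.
have := probability_setC (iid_law S n) mA.
have [fA fAC] : iid_law S n A \is a fin_num /\ iid_law S n (~` A) \is a fin_num.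
  by split; apply: fin_num_measure => //; exact: measurableC.
rewrite -(fineK fA) -(fineK fAC) -EFinB => -[eA].
by rewrite lee_fin; lra.
Qed.

End mcdiarmid.

(** * Suprema over a family of functions *)

Section sup_image.
Context (I : Type) (R : realType) (H : set I) (K : R).
Implicit Types F G : I -> R.

(** The bound [K] guarantees that the real-valued [sup] is a genuine upper bound. *)
Lemma le_sup_image F h : (forall h, H h -> F h <= K) -> H h ->
  F h <= sup [set F h | h in H].
Proof.
move=> FK Hh; apply: ub_le_sup; last by exists h.
by exists K => _ [k Hk <-]; exact: FK.
Qed.

Hypothesis H0 : H !=set0.

Lemma sup_image_le F a : (forall h, H h -> F h <= a) ->
  sup [set F h | h in H] <= a.
Proof.
move=> Fa; apply: ge_sup; first by case: H0 => h Hh; exists (F h), h.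
by move=> _ [h Hh <-]; exact: Fa.
Qed.

(** Carries a difference bound valid for each member over to the supremum. *)
Lemma sup_image_leD F G c : (forall h, H h -> G h <= K) ->
  (forall h, H h -> F h <= G h + c) ->
  sup [set F h | h in H] <= sup [set G h | h in H] + c.
Proof.
move=> GK FG; apply: sup_image_le => h Hh.
by apply: le_trans (FG _ Hh) _; rewrite lerD2r le_sup_image.
Qed.

Lemma norm_sup_image_le F : (forall h, H h -> `|F h| <= K) ->
  `|sup [set F h | h in H]| <= K.
Proof.
move=> FK.
have FK' h : H h -> F h <= K.
  by move=> Hh; exact: le_trans (ler_norm _) (FK _ Hh).
rewrite ler_norml sup_image_le// andbT; case: (H0) => h Hh.
apply: le_trans (le_sup_image FK' Hh).
by have := FK _ Hh; rewrite ler_norml => /andP[].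
Qed.

End sup_image.

(** * Boundedness and bounded differences of the learning quantities *)

Section dual_learning.
Context (d1 d2 : measure_display) (X : measurableType d1)
  (Y : measurableType d2) (R : realType) (S : probability (X * Y)%type R)
  (H : set ((X -> Y) * (Y -> X))) (l1 : Y -> Y -> R) (l2 : X -> X -> R) (M : R).
Context (m : nat).
Hypothesis H0 : H !=set0.
Hypothesis loss_bounded : forall h, H h -> forall z : X * Y,
  0 <= dual_loss l1 l2 h z <= M.
Hypothesis m_ge1 : (1 <= m)%N.
Hypothesis loss_measurable : forall h, H h ->
  measurable_fun [set: X * Y] (dual_loss l1 l2 h).
Hypothesis rademacher_measurable : forall s : {ffun 'I_m -> bool},
  measurable_fun [set: m.-tuple (X * Y)] (rademacher_sup l1 l2 H s).
Hypothesis deviation_measurable : measurable_fun [set: m.-tuple (X * Y)]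
  (@uniform_deviation _ _ X Y R l1 l2 S H m).

Local Notation L := (dual_loss l1 l2).
Local Notation Phi := (@uniform_deviation _ _ X Y R l1 l2 S H m).
Local Notation Rad := (@empirical_rademacher _ _ X Y R l1 l2 H m).
Local Notation Eloss := (expected_loss l1 l2 S).

Let mR0 : 0 < m%:R :> R. Proof. by rewrite ltr0n. Qed.

(** Covers both the empirical loss, with all signs positive, and the averages inside the Rademacher
    complexity. *)
Definition signed_average (s : 'I_m -> bool) (h : (X -> Y) * (Y -> X))
    (Z : m.-tuple (X * Y)) : R :=
  m%:R^-1 * \sum_(i < m) (-1) ^+ s i * L h (tnth Z i).

Lemma empirical_lossE h (Z : m.-tuple (X * Y)) :
  empirical_loss l1 l2 Z h = signed_average (fun=> false) h Z.
Proof.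
by congr (_ * _); apply: eq_bigr => i _; rewrite expr0 mul1r.
Qed.

Lemma norm_signed_average_le s h Z : H h -> `|signed_average s h Z| <= M.
Proof.
move=> Hh; rewrite normrM ger0_norm ?invr_ge0 ?ler0n// mulrC ler_pdivrMr//.
apply: le_trans (ler_norm_sum _ _ _) _.
apply: (@le_trans _ _ (\sum_(i < m) M)); last first.
  by rewrite sumr_const card_ord mulr_natr.
apply: ler_sum => i _; rewrite normrM normr_sign mul1r.
by have /andP[L0 LM] := loss_bounded Hh (tnth Z i); rewrite ger0_norm.
Qed.

(** Only the summand at [i] changes, and two losses in [0, M] differ by at most [M], whatever the
    sign. *)
Lemma signed_average_bounded_differences s h : H h ->
  bounded_differences (M / m%:R) (signed_average s h).
Proof.
move=> Hh i Z Z' ZZ'; rewrite /signed_average mulrC [_^-1 * _]mulrC -mulrDl.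
rewrite ler_pM2r ?invr_gt0//.
rewrite (bigD1 i)//= [in leRHS](bigD1 i)//= addrAC.
under eq_bigr => j ji do rewrite ZZ'//.
rewrite lerD2r.
have /andP[? ?] := loss_bounded Hh (tnth Z i).
have /andP[? ?] := loss_bounded Hh (tnth Z' i).
by case: (s i); rewrite ?expr1 ?expr0; lra.
Qed.

Lemma bounded_measurable_loss h : H h -> bounded_measurable (L h).
Proof.
move=> Hh; split; first exact: loss_measurable.
exists M => z; have /andP[L0 LM] := loss_bounded Hh z.
by rewrite ger0_norm.
Qed.

Lemma bounded_measurable_signed_average s h : H h ->
  bounded_measurable (signed_average s h).
Proof.
move=> Hh; apply: bounded_measurableZ.
apply: bounded_measurable_sum => i; apply: bounded_measurableZ.
apply: (bounded_measurable_comp (bounded_measurable_loss Hh)).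
exact: measurable_tnth.
Qed.

Lemma expected_lossE h : Eloss h = \int[S]_z L h z.
Proof. by rewrite /expected_loss unlock. Qed.

Lemma norm_expected_loss_le h : H h -> `|Eloss h| <= M.
Proof.
move=> Hh; rewrite expected_lossE; apply: norm_mean_le.
  exact: bounded_measurable_loss.
by move=> z; have /andP[L0 LM] := loss_bounded Hh z; rewrite ger0_norm.
Qed.

(** A crude bound, used to make the suprema finite; it does not enter the final constants. *)
Lemma norm_deviation_le h (Z : m.-tuple (X * Y)) : H h ->
  `|Eloss h - empirical_loss l1 l2 Z h| <= M + M.
Proof.
move=> Hh; rewrite (le_trans (ler_normB _ _))// lerD ?norm_expected_loss_le//.
by rewrite empirical_lossE norm_signed_average_le.
Qed.

Lemma deviation_le h (Z : m.-tuple (X * Y)) : H h ->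
  Eloss h - empirical_loss l1 l2 Z h <= M + M.
Proof. by move=> Hh; exact: le_trans (ler_norm _) (norm_deviation_le _ Hh). Qed.

Lemma mean_empirical_loss h : H h ->
  \int[iid_law S m]_Z empirical_loss l1 l2 Z h = Eloss h.
Proof.
move=> Hh; have bL := bounded_measurable_loss Hh.
have bLi i : bounded_measurable (fun Z : m.-tuple (X * Y) => L h (tnth Z i)).
  by apply: (bounded_measurable_comp bL); exact: measurable_tnth.
rewrite expected_lossE meanZ; last exact: bounded_measurable_sum.
rewrite mean_sum//; under eq_bigr do rewrite mean_iid_tnth//.
by rewrite sumr_const card_ord -[X in _ * X]mulr_natl mulKf// gt_eqF.
Qed.

Lemma bounded_measurable_rademacher_sup s :
  bounded_measurable (@rademacher_sup _ _ X Y R l1 l2 H m s).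
Proof.
split; first exact: rademacher_measurable.
exists M => Z; apply: norm_sup_image_le => // h.
exact: norm_signed_average_le.
Qed.

Lemma bounded_measurable_deviation : bounded_measurable Phi.
Proof.
split=> //; exists (M + M) => Z.
by apply: norm_sup_image_le => // h; exact: norm_deviation_le.
Qed.

Lemma bounded_measurable_empirical_rademacher : bounded_measurable Rad.
Proof.
apply/bounded_measurableZ/bounded_measurable_sum => s.
exact: bounded_measurable_rademacher_sup.
Qed.

Lemma rademacherE : rademacher l1 l2 S H m = \int[iid_law S m]_Z Rad Z.
Proof. by rewrite /rademacher unlock. Qed.

Lemma deviation_bounded_differences : bounded_differences (M / m%:R) Phi.
Proof.
move=> i Z Z' ZZ'; apply: (@sup_image_leD _ _ _ (M + M)) => // h Hh.
  exact: deviation_le.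
rewrite -addrA lerD2l lerNl opprD opprK lerBlDr !empirical_lossE.
apply: (@signed_average_bounded_differences _ _ Hh i) => j ji.
by rewrite ZZ'.
Qed.

Lemma empirical_rademacher_bounded_differences :
  bounded_differences (M / m%:R) Rad.
Proof.
move=> i Z Z' ZZ'; rewrite /empirical_rademacher.
have card_signs : \sum_(s : {ffun 'I_m -> bool}) M / m%:R = 2 ^+ m * (M / m%:R).
  by rewrite sumr_const card_ffun card_bool card_ord -[_ *+ _]mulr_natl natrX.
(* Writes [M / m%:R] as its own average over the [2 ^+ m] sign patterns, so that the comparison is
   made pattern by pattern. *)
rewrite -(mulKf (_ : 2 ^+ m != 0 :> R) (M / m%:R)) ?expf_neq0//.
rewrite -mulrDr ler_pM2l ?invr_gt0 ?exprn_gt0// -card_signs -big_split/=.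
apply: ler_sum => s _; apply: (@sup_image_leD _ _ _ M) => // h Hh.
  exact: le_trans (ler_norm _) (norm_signed_average_le s Z' Hh).
exact: (@signed_average_bounded_differences s _ Hh i).
Qed.

(** * Symmetrization *)

Let neg (s : {ffun 'I_m -> bool}) : {ffun 'I_m -> bool} := [ffun i => ~~ s i].

(** Each recombination puts ghost points under plus signs and sample points under minus signs.
    Together the two use every point once, so the two signed averages add up exactly to the left
    side. *)
Lemma ghost_sample_le s h Z Z' : H h ->
  empirical_loss l1 l2 Z' h - empirical_loss l1 l2 Z h <=
  rademacher_sup l1 l2 H s (mix (neg s) Z Z') +
  rademacher_sup l1 l2 H (neg s) (mix s Z Z').
Proof.
move=> Hh.
have sup_ge (s' : {ffun 'I_m -> bool}) W :
    signed_average s' h W <= rademacher_sup l1 l2 H s' W.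
  apply: (@le_sup_image _ _ H M (fun h => signed_average s' h W)) => // k Hk.
  exact: le_trans (ler_norm _) (norm_signed_average_le _ _ Hk).
apply: le_trans (lerD (sup_ge s _) (sup_ge (neg s) _)).
rewrite le_eqVlt; apply/orP; left; apply/eqP.
rewrite /empirical_loss /signed_average -mulrBr -mulrDr -sumrB -big_split/=.
congr (_ * _); apply: eq_bigr => i _; rewrite !tnth_mktuple !ffunE.
by case: (s i) => /=; ring.
Qed.

(* Bounding the ghost-sample difference by two sign-suprema of measurable
   recombinations of the two samples, before taking the supremum over [H],
   avoids having to integrate the supremum over [H] of the differences, which
   need not be measurable on the double sample. *)
Lemma mean_deviation_le_sign s : \int[iid_law S m]_Z Phi Z <=
  \int[iid_law S m]_Z rademacher_sup l1 l2 H s Z +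
  \int[iid_law S m]_Z rademacher_sup l1 l2 H (neg s) Z.
Proof.
have bR := bounded_measurable_rademacher_sup.
have bA := bounded_measurable_mix (neg s) (bR s).
have bB := bounded_measurable_mix s (bR (neg s)).
have bA1 := bounded_measurable_mean1 (iid_law S m) (iid_law S m) bA.
have bB1 := bounded_measurable_mean1 (iid_law S m) (iid_law S m) bB.
rewrite -(mean_mix S (neg s) (bR s)) -(mean_mix S s (bR (neg s))) -meanD//.
apply: le_mean => //.
- exact: bounded_measurable_deviation.
- exact: bounded_measurableD.
move=> Z; apply: sup_image_le => // h Hh.
have bE : bounded_measurable
    (fun Z : m.-tuple (X * Y) => empirical_loss l1 l2 Z h).
  under eq_fun do rewrite empirical_lossE.
  exact: bounded_measurable_signed_average.
have bAZ := bounded_measurable_pair1 bA Z.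
have bBZ := bounded_measurable_pair1 bB Z.
(* The expected loss becomes the mean empirical loss of the ghost sample, so both sides are means
   over [Z']. *)
rewrite -(mean_empirical_loss Hh).
rewrite -(mean_cst (iid_law S m) (empirical_loss _ _ Z h)).
rewrite -meanB//; last exact: bounded_measurable_cst.
rewrite -meanD//; apply: le_mean.
- by apply: bounded_measurableB => //; exact: bounded_measurable_cst.
- exact: bounded_measurableD.
- by move=> Z'; exact: ghost_sample_le.
Qed.

(** Averages the previous bound over all sign patterns. As [neg] is an involution, both terms
    contribute the same sum, whence the factor 2. *)
Lemma mean_deviation_le :
  \int[iid_law S m]_Z Phi Z <= 2 * rademacher l1 l2 S H m.
Proof.
have bR := bounded_measurable_rademacher_sup.
rewrite rademacherE meanZ; last exact: bounded_measurable_sum.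
rewrite mean_sum// mulrCA mulrC ler_pdivlMr ?exprn_gt0//.
have -> : 2 * \sum_s \int[iid_law S m]_Z rademacher_sup l1 l2 H s Z =
    \sum_s (\int[iid_law S m]_Z rademacher_sup l1 l2 H s Z +
            \int[iid_law S m]_Z rademacher_sup l1 l2 H (neg s) Z).
  rewrite big_split/= mulr2n mulrDl mul1r; congr (_ + _).
  rewrite (reindex_inj (h := neg))//; apply: can_inj (neg) _ => s.
  by apply/ffunP => i; rewrite !ffunE negbK.
apply: (@le_trans _ _
    (\sum_(s : {ffun 'I_m -> bool}) \int[iid_law S m]_Z Phi Z)).
  by rewrite sumr_const card_ffun card_bool card_ord -[leRHS]mulr_natr natrX.
by apply: ler_sum => s _; exact: mean_deviation_le_sign.
Qed.

(** Turns the events of the theorem into sublevel sets. Since [a] is arbitrary for each [Z], it may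
    contain the empirical complexity of [Z]. *)
Lemma uniform_deviation_leP (a : R) (Z : m.-tuple (X * Y)) :
  Phi Z <= a <-> forall h, H h -> Eloss h <= empirical_loss l1 l2 Z h + a.
Proof.
split=> [Za h Hh|Za]; last by apply: sup_image_le => // h /Za; rewrite lerBlDl.
rewrite -lerBlDl; apply: le_trans Za.
apply: (@le_sup_image _ _ H (M + M)
  (fun h => Eloss h - empirical_loss l1 l2 Z h)) => // k.
exact: deviation_le.
Qed.

End dual_learning.

(** * The two generalization bounds *)

Unset Implicit Arguments.
Set Strict Implicit.

Theorem theorem1 (d1 d2 : measure_display)
  (X : measurableType d1) (Y : measurableType d2) (R : realType)
  (S : probability (X * Y)%type R)
  (calP : set (X -> Y)) (calD : set (Y -> X))
  (H : set ((X -> Y) * (Y -> X)))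
  (H_sub : H `<=` calP `*` calD)
  (H_infinite : infinite_set H)
  (l1 : Y -> Y -> R) (l2 : X -> X -> R) (M : R)
  (loss_bounded : forall h, H h -> forall z : X * Y,
     0 <= dual_loss l1 l2 h z <= M)
  (m : nat) (m_ge1 : (1 <= m)%N)
  (loss_measurable : forall h, H h ->
     measurable_fun [set: X * Y] (dual_loss l1 l2 h))
  (rademacher_measurable : forall s : {ffun 'I_m -> bool},
     measurable_fun [set: m.-tuple (X * Y)] (rademacher_sup l1 l2 H s))
  (deviation_measurable :
     measurable_fun [set: m.-tuple (X * Y)]
       (@uniform_deviation _ _ X Y R l1 l2 S H m))
  (delta : R) (delta_gt0 : 0 < delta) :
  ((1 - delta)%:E <=
     iid_law S m [set Z : m.-tuple (X * Y) | forall h, H h ->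
       (expected_loss l1 l2 S h <=
         empirical_loss l1 l2 Z h + 2 * rademacher l1 l2 S H m
         + M * Num.sqrt (1 / (2 * m%:R) * ln (1 / delta)))%R])%E
  /\
  ((1 - delta)%:E <=
     iid_law S m [set Z : m.-tuple (X * Y) | forall h, H h ->
       (expected_loss l1 l2 S h <=
         empirical_loss l1 l2 Z h + 2 * empirical_rademacher l1 l2 H Z
         + 3 * M * Num.sqrt (1 / (2 * m%:R) * ln (1 / delta)))%R])%E.
Proof.
set e := Num.sqrt _.
have H0 := infinite_setN0 H_infinite.
have mR0 : 0 < m%:R :> R by rewrite ltr0n.
pose Phi := @uniform_deviation _ _ X Y R l1 l2 S H m.
pose Rad := @empirical_rademacher _ _ X Y R l1 l2 H m.
have M_ge0 : 0 <= M.
  have [z _] := probability_setT_nonempty S.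
  by have [h /loss_bounded/(_ z)/andP[]] := H0; exact: le_trans.
have leP := uniform_deviation_leP S H0 loss_bounded m_ge1 loss_measurable.
have mean_le := mean_deviation_le H0 loss_bounded m_ge1 loss_measurable
  rademacher_measurable deviation_measurable.
have Phi_diff : bounded_differences (M / m%:R) Phi.
  exact: deviation_bounded_differences loss_measurable.
have Rad_diff : bounded_differences (M / m%:R) Rad.
  exact: empirical_rademacher_bounded_differences.
have bPhi : bounded_measurable Phi.
  exact: bounded_measurable_deviation H0 loss_bounded m_ge1 loss_measurable _.
have bRad : bounded_measurable Rad.
  exact: bounded_measurable_empirical_rademacher H0 loss_bounded m_ge1 _.
split.
- rewrite (_ : [set _ | _] =
      [set Z | Phi Z <= 2 * rademacher l1 l2 S H m + M * e]); last first.
    apply/seteqP; split => Z /=.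
      by move=> Za; apply/leP => h /Za; rewrite addrA.
    by move=> /leP Za h /Za; rewrite addrA.
  have := mcdiarmid S m_ge1 (divr_ge0 M_ge0 (ltW mR0)) bPhi Phi_diff
    delta_gt0.
  move=> /le_trans; apply; apply: le_measure.
  + by rewrite inE; apply: measurable_le_cst; case: bPhi.
  + by rewrite inE; apply: measurable_le_cst; case: bPhi.
  (* Symmetrization bounds the mean, and [m%:R * (M / m%:R)] is [M]. *)
  + move=> Z /= /le_trans; apply; apply: lerD; first exact: mean_le.
    by rewrite mulrCA divff ?mulr1// gt_eqF.
- pose f Z := Phi Z - 2 * Rad Z.
  have bf : bounded_measurable f.
    exact/bounded_measurableB/bounded_measurableZ.
  have fd : bounded_differences (3 * M / m%:R) f.
    move=> i Z Z' ZZ'; rewrite /f.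
    have := Phi_diff _ _ _ ZZ'.
    (* The samples are exchanged because [Rad] enters [f] negatively; one difference from [Phi] and
       two from [Rad] add up to [3 * M / m%:R]. *)
    have := Rad_diff i Z' Z (fun j ji => esym (ZZ' j ji)).
    by rewrite -mulrA; lra.
  rewrite (_ : [set _ | _] = [set Z | f Z <= 3 * M * e]); last first.
    apply/seteqP; split => Z /=.
      move=> Za; rewrite /f lerBlDl; apply/leP => h /Za.
      by rewrite addrA.
    by rewrite /f lerBlDl => /leP Za h /Za; rewrite addrA.
  have c0 : 0 <= 3 * M / m%:R by rewrite divr_ge0 ?mulr_ge0// ltW.
  have := mcdiarmid S m_ge1 c0 bf fd delta_gt0.
  move=> /le_trans; apply; apply: le_measure.
  + by rewrite inE; apply: measurable_le_cst; case: bf.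
  + by rewrite inE; apply: measurable_le_cst; case: bf.
  + move=> Z /= /le_trans; apply; rewrite mulrCA divff ?gt_eqF// mulr1.
    rewrite gerDr /f meanB//; last exact: bounded_measurableZ.
    by rewrite meanZ// -rademacherE subr_le0 mean_le.
Qed.
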